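(* Let $\mathcal{H}$ be a stochastic hybrid system, let $\mathcal{T}_{\mathcal{H}}=(S_{\mathcal{H}},\Sigma_{\mathcal{H}},\kappa_{\mathcal{H}})$ be the stochastic transition system it induces, and let $B\in\Sigma_{\mathcal{H}}$. If $\mathcal{H}$ is cycle-reset, then it has a finite and sound abstraction compatible with $B$ and with the locations; that is, there exist a stochastic transition system $\mathcal{T}_2=(S_2,\Sigma_2,\kappa_2)$ with $S_2$ finite and $\Sigma_2=2^{S_2}$, and a measurable function $\alpha\colon(S_{\mathcal{H}},\Sigma_{\mathcal{H}})\to(S_2,\Sigma_2)$ such that $\mathcal{T}_2$ is a sound $\alpha$-abstraction of $\mathcal{T}_{\mathcal{H}}$, and the set $B$ as well as each set $\{\ell\}\times\mathbb{R}^n$ for $\ell$ a location of $\mathcal{H}$ is $\alpha$-closed.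
   Context: Stochastic transition systems. An STS is a tuple $\mathcal{T}=(S,\Sigma,\kappa)$ with $(S,\Sigma)$ a measurable space and $\kappa\colon S\times\Sigma\to[0,1]$ a Markov kernel ($\kappa(s,\cdot)$ is a probability measure for every $s$; $\kappa(\cdot,A)$ is measurable for every $A\in\Sigma$). $\mathrm{Dist}(S)$ is the set of probability distributions on $(S,\Sigma)$. For $\mu\in\mathrm{Dist}(S)$, $\mathrm{Prob}^{\mathcal{T}}_\mu$ is the probability measure on runs (infinite sequences $s_0s_1\ldots$ of states) for which $s_0$ has law $\mu$ and $s_{i+1}$ is drawn from $\kappa(s_i,\cdot)$. $\mathbf{F}\,B$ is the set of runs with $s_i\in B$ for some $i\ge 0$. For $\mu\in\mathrm{Dist}(S)$, $\Omega_{\mathcal{T}}(\mu)\in\mathrm{Dist}(S)$ is defined by $\Omega_{\mathcal{T}}(\mu)(A)=\int_{s\in S}\kappa(s,A)\,d\mu(s)$. Abstractions. Let $\mathcal{T}_1=(S_1,\Sigma_1,\kappa_1)$ and $\mathcal{T}_2=(S_2,\Sigma_2,\kappa_2)$ be STSs and $\alpha\colon(S_1,\Sigma_1)\to(S_2,\Sigma_2)$ be measurable. A set $B\in\Sigma_1$ is $\alpha$-closed (equivalently, $\alpha$ is compatible with $B$) if $B=\alpha^{-1}(\alpha(B))$. The pushforward is $\alpha_\#(\mu)(C)=\mu(\alpha^{-1}(C))$ for $\mu\in\mathrm{Dist}(S_1)$, $C\in\Sigma_2$. Two probability distributions on the same measurable space are qualitatively equivalent if they assign positive probability to the same measurable sets.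 $\mathcal{T}_2$ is an $\alpha$-abstraction of $\mathcal{T}_1$ if for all $\mu\in\mathrm{Dist}(S_1)$, $\alpha_\#(\Omega_{\mathcal{T}_1}(\mu))$ is qualitatively equivalent to $\Omega_{\mathcal{T}_2}(\alpha_\#(\mu))$. It is a sound $\alpha$-abstraction if moreover for all $\mu\in\mathrm{Dist}(S_1)$ and all $C\in\Sigma_2$, $\mathrm{Prob}^{\mathcal{T}_2}_{\alpha_\#(\mu)}(\mathbf{F}\,C)=1$ implies $\mathrm{Prob}^{\mathcal{T}_1}_\mu(\mathbf{F}\,\alpha^{-1}(C))=1$. Hybrid systems. A hybrid system (HS) is a tuple $(L,X,\mathcal{A},E,\gamma,\mathcal{I},\mathcal{G},\mathcal{R})$ where $L$ is a finite set of locations; $X=\{x_1,\ldots,x_n\}$ is a finite set of continuous variables; $\mathcal{A}$ is a finite alphabet of events; $E\subseteq L\times\mathcal{A}\times L$ is a finite set of edges; for each $\ell\in L$, $\gamma_\ell\colon\mathbb{R}^n\times\mathbb{R}^+\to\mathbb{R}^n$ is a continuous function (the dynamics in $\ell$; $\mathbb{R}^+=[0,\infty)$); $\mathcal{I}(\ell)\subseteq\mathbb{R}^n$ is the invariant of $\ell$; $\mathcal{G}(e)\subseteq\mathbb{R}^n$ is the guard of edge $e$; and for each edge $e$ and $v\in\mathbb{R}^n$, $\mathcal{R}_e(v)\subseteq\mathbb{R}^n$ is the reset. States are the elements of $L\times\mathbb{R}^n$. There is a switch-transition $(\ell,v)\xrightarrow{e}(\ell',v')$ for $e=(\ell,a,\ell')\in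 E$ if $v\in\mathcal{I}(\ell)\cap\mathcal{G}(e)$ and $v'\in\mathcal{R}_e(v)\cap\mathcal{I}(\ell')$; edge $e$ is then said to be enabled at $(\ell,v)$. There is a delay-transition $(\ell,v)\xrightarrow{\tau}(\ell,v')$ for $\tau\in\mathbb{R}^+$ if $\gamma_\ell(v,\tau')\in\mathcal{I}(\ell)$ for all $0\le\tau'\le\tau$ and $v'=\gamma_\ell(v,\tau)$. A mixed transition $\xrightarrow{\tau,e}$ is a delay-transition $\xrightarrow{\tau}$ followed by a switch-transition $\xrightarrow{e}$. For $s=(\ell,v)$, $s+\tau=(\ell,\gamma_\ell(v,\tau))$. $I(s,e)$ is the set of $\tau\in\mathbb{R}^+$ such that $s\xrightarrow{\tau,e}s'$ for some $s'$, and $I(s)=\bigcup_e I(s,e)$. Standing assumption: all states are non-blocking, i.e., $I(s)\ne\emptyset$ for every state $s$. Stochastic hybrid systems. A stochastic hybrid system (SHS) is a HS (with guards, invariants and resets Borel sets) together with: for each state $s$, a probability distribution $\mu_s$ on $\mathbb{R}^+$ (delays) with $\mu_s(I(s))=1$; for each edge $e$ and $v\in\mathbb{R}^n$, a probability distribution $\eta_e(v)$ on $\mathcal{R}_e(v)$; and for each state $s$ at which some edge is enabled, a probability distribution $p_s$ on $E$ such that $p_s(e)>0$ if and only if $e$ is enabled at $s$. Induced STS. $\mathcal{T}_{\mathcal{H}}=(S_{\mathcal{H}},\Sigma_{\mathcal{H}},\kappa_{\mathcal{H}})$, where $S_{\mathcal{H}}=L\times\mathbb{R}^n$, $\Sigma_{\mathcal{H}}$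 is the product of $2^L$ and the Borel $\sigma$-algebra of $\mathbb{R}^n$, and for $s=(\ell,v)$, $B\in\Sigma_{\mathcal{H}}$, $$\kappa_{\mathcal{H}}(s,B)=\int_{\tau\in\mathbb{R}^+}\sum_{e=(\ell,a,\ell')\in E}\Big(p_{s+\tau}(e)\int_{v''\in\mathbb{R}^n}\mathbf{1}_B(\ell',v'')\,d\big(\eta_e(\gamma_\ell(v,\tau))\big)(v'')\Big)d\mu_s(\tau).$$ The data of an SHS are assumed to be such that $\kappa_{\mathcal{H}}$ is a (well-defined) Markov kernel, so that $\mathcal{T}_{\mathcal{H}}$ is an STS. Cycle-reset. An edge $e$ of an SHS is strongly reset if there exist $\mathcal{R}_e^*\subseteq\mathbb{R}^n$ and $\eta_e^*\in\mathrm{Dist}(\mathcal{R}_e^* )$ such that for all $v\in\mathcal{G}(e)$, $\mathcal{R}_e(v)=\mathcal{R}_e^*$ and $\eta_e(v)=\eta_e^*$. An SHS is cycle-reset if every simple cycle of its discrete graph (vertices $L$, edges $E$) contains a strongly reset edge. *)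

(* Defs.v *)
From HB Require Import structures.
From mathcomp Require Import all_boot all_order all_algebra.
From mathcomp Require Import all_classical all_reals all_analysis measurable_realfun.

Set Implicit Arguments.
Unset Strict Implicit.
Unset Printing Implicit Defensive.
Import Order.TTheory GRing.Theory Num.Theory.
Import numFieldNormedType.Exports.

Local Open Scope classical_set_scope.
Local Open Scope ring_scope.
Local Open Scope ereal_scope.

Record sts (R : realType) := STS {
  sts_disp : measure_display ;
  sts_state :> measurableType sts_disp ;
  sts_kernel : R.-pker sts_state ~> sts_state }.

Definition coordinate_sets d (S : measurableType d) : set_system (nat -> S) :=
  \bigcup_i preimage_set_system setT (fun w : nat -> S => w i) measurable.

Definition runs d (S : measurableType d) := g_sigma_algebraType (@coordinate_sets d S).

Section sts_theory.
Context (R : realType).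
Implicit Types T : sts R.

Definition Omega T (mu : probability T R) (A : set T) : \bar R :=
  \int[mu]_s sts_kernel T s A.

(** [path_prob [:: A1; ...; An] s] is the iterated integral
    int_{A1} kappa(s, ds1) int_{A2} kappa(s1, ds2) ... int_{An} kappa(s(n-1), dsn). *)
Fixpoint path_prob T (As : seq (set T)) (s : T) : \bar R :=
  if As is A :: As' then \int[sts_kernel T s]_(t in A) path_prob As' t else 1.

(** [P] is the law of the runs of [T] started from [mu]. By the Ionescu-Tulcea
    theorem there is exactly one such [P], for all [T] and [mu]. *)
Definition is_run_measure T (mu : probability T R)
    (P : probability (runs T) R) : Prop :=
  forall (A : set T) (As : seq (set T)),
    measurable A -> (forall i, measurable (nth setT As i)) ->
    P [set w | forall i, nth setT (A :: As) i (w i)] =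
    \int[mu]_(s in A) path_prob As s.

Definition reach d (S : measurableType d) (C : set S) : set (runs S) :=
  [set w | exists i, C (w i)].

Definition qualitatively_equivalent d (S : measurableType d)
    (m1 m2 : set S -> \bar R) : Prop :=
  forall A, measurable A -> (0 < m1 A) <-> (0 < m2 A).

Definition is_abstraction T1 T2 (alpha : {mfun T1 >-> T2}) : Prop :=
  forall mu : probability T1 R,
    qualitatively_equivalent (pushforward (Omega mu) alpha)
                             (Omega (distribution mu alpha)).

Definition is_sound_abstraction T1 T2 (alpha : {mfun T1 >-> T2}) : Prop :=
  is_abstraction alpha /\
  forall (mu : probability T1 R) (C : set T2), measurable C ->
  forall (P1 : probability (runs T1) R) (P2 : probability (runs T2) R),
    is_run_measure mu P1 -> is_run_measure (distribution mu alpha) P2 ->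
    P2 (reach C) = 1 -> P1 (reach (alpha @^-1` C)) = 1.

Definition finite_sts T : Prop :=
  finite_set [set: T] /\ forall A : set T, measurable A.

End sts_theory.

Definition alpha_closed (S1 S2 : Type) (alpha : S1 -> S2) (B : set S1) : Prop :=
  B = alpha @^-1` (alpha @` B).

(** [hs_flow l v t] only matters for [0 <= t], and [hs_guard] and [hs_reset] only
    on [hs_edges]. [hs_loc0] makes the set of locations nonempty, because
    measurable types are pointed. *)
Record hybrid_system (R : realType) := HybridSystem {
  hs_loc : finType ;
  hs_loc0 : hs_loc ;
  hs_dim : nat ;
  hs_event : finType ;
  hs_edges : {set hs_loc * hs_event * hs_loc} ;
  hs_flow : hs_loc -> 'rV[R]_hs_dim -> R -> 'rV[R]_hs_dim ;
  hs_flow_continuous : forall l,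
    {within [set vt : 'rV[R]_hs_dim * R | (0 <= vt.2)%R],
      continuous (fun vt => hs_flow l vt.1 vt.2)} ;
  hs_inv : hs_loc -> set 'rV[R]_hs_dim ;
  hs_guard : hs_loc * hs_event * hs_loc -> set 'rV[R]_hs_dim ;
  hs_reset : hs_loc * hs_event * hs_loc -> 'rV[R]_hs_dim -> set 'rV[R]_hs_dim }.

Section hybrid_system_theory.
Context (R : realType) (H : hybrid_system R).

Definition edge : Type := (hs_loc H * hs_event H * hs_loc H)%type.
Definition source (e : edge) : hs_loc H := e.1.1.
Definition target (e : edge) : hs_loc H := e.2.

Definition loc_space : Type := hs_loc H.
HB.instance Definition _ := Choice.on loc_space.
HB.instance Definition _ := isPointed.Build loc_space (hs_loc0 H).
HB.instance Definition _ := @isMeasurable.Build default_measure_display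
  loc_space (@discrete_measurable loc_space)
  (@discrete_measurable0 _) (@discrete_measurableC _) (@discrete_measurableU _).

Definition vec_space := g_sigma_algebraType (@open 'rV[R]_(hs_dim H)).

Definition hstate : Type := (loc_space * vec_space)%type.
HB.instance Definition _ := Measurable.on hstate.

Implicit Types (s : hstate) (e : edge) (tau : R).

Definition switch e s s' : Prop :=
  [/\ e \in hs_edges H, s.1 = source e, s'.1 = target e,
      (hs_inv s.1 `&` hs_guard e) s.2 & (hs_reset e s.2 `&` hs_inv s'.1) s'.2].

Definition enabled s e : Prop := exists s', switch e s s'.

Definition shift s tau : hstate := (s.1, hs_flow s.1 s.2 tau).

Definition delay tau s s' : Prop :=
  [/\ (0 <= tau)%R,
      forall tau', (0 <= tau' <= tau)%R -> hs_inv s.1 (hs_flow s.1 s.2 tau') &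
      s' = shift s tau].

Definition mixed tau e s s' : Prop := exists2 s'', delay tau s s'' & switch e s'' s'.

(** [delays_of s e] and [delays s] are the sets I(s, e) and I(s). *)
Definition delays_of s e : set R := [set tau | exists s', mixed tau e s s'].

Definition delays s : set R := \bigcup_e delays_of s e.

Definition non_blocking : Prop := forall s, delays s !=set0.

End hybrid_system_theory.

Section kappa.
Context (R : realType) (H : hybrid_system R).
Variables (mu : hstate H -> probability R R)
  (eta : edge H -> vec_space H -> probability (vec_space H) R)
  (p : hstate H -> edge H -> R).

Definition kappa_integrand (s : hstate H) (B : set (hstate H)) (tau : R) : \bar R :=
  \sum_(e in hs_edges H | source e == s.1)
    (p (shift s tau) e)%:E *
    \int[eta e (hs_flow s.1 s.2 tau)]_v (\1_B (target e, v) : R)%:E.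

Definition kappa (s : hstate H) (B : set (hstate H)) : \bar R :=
  \int[mu s]_(tau in [set tau : R | (0 <= tau)%R]) kappa_integrand s B tau.

End kappa.

(** The distribution [p_s], defined only when some edge is enabled at [s], is
    extended by 0. [shs_delays_measurable] is presupposed by [shs_mu_delays].
    The last two fields say that [kappa] is well defined and measurable in its
    first argument; that it is then a Markov kernel is proved below. *)
Record shs (R : realType) := SHS {
  shs_hs :> hybrid_system R ;
  shs_non_blocking : non_blocking shs_hs ;
  shs_inv_measurable : forall l,
    measurable (hs_inv l : set (vec_space shs_hs)) ;
  shs_guard_measurable : forall e, e \in hs_edges shs_hs ->
    measurable (hs_guard e : set (vec_space shs_hs)) ;
  shs_reset_measurable : forall e v, e \in hs_edges shs_hs ->
    measurable (hs_reset e v : set (vec_space shs_hs)) ;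
  shs_mu : hstate shs_hs -> probability R R ;
  shs_delays_measurable : forall s, measurable (@delays _ shs_hs s) ;
  shs_mu_delays : forall s, shs_mu s (delays s) = 1 ;
  shs_eta : edge shs_hs -> vec_space shs_hs -> probability (vec_space shs_hs) R ;
  shs_eta_reset : forall e v, e \in hs_edges shs_hs ->
    shs_eta e v (hs_reset e v) = 1 ;
  shs_p : hstate shs_hs -> edge shs_hs -> R ;
  shs_p_ge0 : forall s e, (0 <= shs_p s e)%R ;
  shs_p_gt0 : forall s e, (0 < shs_p s e)%R <-> enabled s e ;
  shs_p_sum1 : forall s, (exists e, enabled s e) ->
    (\sum_(e in hs_edges shs_hs) shs_p s e = 1)%R ;
  shs_integrand_measurable : forall s B, measurable B ->
    measurable_fun [set tau : R | (0 <= tau)%R]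
      (kappa_integrand shs_eta shs_p s B) ;
  shs_kappa_measurable : forall B, measurable B ->
    measurable_fun setT (fun s => kappa shs_mu shs_eta shs_p s B) }.

Section induced_sts.
Context (R : realType) (H : shs R).

Definition shs_kappa (s : hstate H) (B : set (hstate H)) : \bar R :=
  kappa (@shs_mu _ H) (@shs_eta _ H) (@shs_p _ H) s B.

Notation f := (kappa_integrand (@shs_eta _ H) (@shs_p _ H)).
Notation Rplus := [set tau : R | (0 <= tau)%R].

Let measurable_Rplus : measurable Rplus.
Proof. by rewrite -set_itvcy; exact: measurable_itv. Qed.

Let measurable_section (l : hs_loc H) (B : set (hstate H)) : measurable B ->
  measurable [set v : vec_space H | B (l, v)].
Proof.
move=> mB.
rewrite -[X in measurable X]setTI.
exact: (pair1_measurable (l : loc_space H) measurableT mB).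
Qed.

Let integrandE s (B : set (hstate H)) tau : measurable B ->
  f s B tau = \sum_(e in hs_edges H | source e == s.1)
    (shs_p (shift s tau) e)%:E *
    shs_eta e (hs_flow s.1 s.2 tau) [set v | B (target e, v)].
Proof.
move=> mB; apply: eq_bigr => e _; congr (_ * _).
have mBe := measurable_section (target e) mB.
by rewrite -[X in _ = shs_eta _ _ X]setIT -integral_indic.
Qed.

Let integrand_ge0 s B tau : 0 <= f s B tau.
Proof.
apply: sume_ge0 => e _; apply: mule_ge0; first by rewrite lee_fin shs_p_ge0.
by apply: integral_ge0 => v _; rewrite lee_fin.
Qed.

Let kappa0 s : shs_kappa s set0 = 0.
Proof.
rewrite /shs_kappa /kappa integral0_eq// => tau _; rewrite integrandE//.
rewrite big1// => e _; rewrite (_ : [set v | _] = set0) ?measure0 ?mule0//.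
Qed.

Let kappa_ge0 s B : 0 <= shs_kappa s B.
Proof. by apply: integral_ge0 => tau _; exact: integrand_ge0. Qed.

Let kappa_sigma_additive s : semi_sigma_additive (shs_kappa s).
Proof.
move=> F mF tF mUF.
rewrite [X in _ --> X](_ : _ = \sum_(i <oo) shs_kappa s (F i)).
  exact: is_cvg_ereal_nneg_natsum.
rewrite /shs_kappa /kappa -integral_nneseries//; last first.
  by move=> n; exact: shs_integrand_measurable.
apply: eq_integral => tau _; rewrite integrandE//.
under eq_eseriesr do rewrite integrandE//.
rewrite nneseries_sum//; last first.
  by move=> e n _ ; rewrite mule_ge0// lee_fin shs_p_ge0.
apply: eq_bigr => e _; rewrite nneseriesZl//.
congr (_ * _); rewrite [in LHS](_ : [set v | _] =
    \bigcup_i [set v | F i (target e, v)]); last first.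
  by apply/seteqP; split => v [i _ Fi]; exists i.
apply/esym/cvg_lim => //; apply: measure_semi_sigma_additive.
- by move=> i; exact: measurable_section.
- move/trivIsetP in tF; apply/trivIsetP => i j _ _ ij.
  have Fij := tF i j Logic.I Logic.I ij.
  apply/seteqP; split => // v [Fi Fj].
  by have : (F i `&` F j) (target e, v) by []; rewrite Fij.
- exact: bigcupT_measurable (fun i => measurable_section _ (mF i)).
Qed.

HB.instance Definition _ s := isMeasure.Build _ (hstate H) R (shs_kappa s)
  (kappa0 s) (kappa_ge0 s) (@kappa_sigma_additive s).

Definition shs_kernel (s : hstate H) : {measure set (hstate H) -> \bar R} :=
  shs_kappa s.

HB.instance Definition _ :=
  isKernel.Build _ _ (hstate H) (hstate H) R shs_kernel
    (fun B mB => @shs_kappa_measurable _ H B mB).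

Let integrandT s tau : delays s tau -> f s setT tau = 1.
Proof.
move=> [e _ [s' [s'' [tau0 _ ->] sw]]]; rewrite integrandE//.
rewrite -[RHS]/(1%R%:E) -(@shs_p_sum1 _ H (shift s tau)); last by exists e, s'.
rewrite -sumEFin [RHS](bigID (fun e => source e == s.1))/=.
rewrite [X in _ + X]big1 ?adde0; last first.
  move=> e' /andP[_ se']; congr EFin; apply/eqP; rewrite eq_le shs_p_ge0 andbT.
  rewrite leNgt; apply/negP => /shs_p_gt0[s1 [_ /= ss _ _ _]].
  by rewrite ss eqxx in se'.
apply: eq_bigr => e' _; rewrite [X in _ * X](_ : _ = 1) ?mule1//.
rewrite -(@probability_setT _ _ _ (shs_eta e' (hs_flow s.1 s.2 tau))).
by congr (shs_eta _ _ _); apply/seteqP; split.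
Qed.

Let kernelT s : shs_kernel s setT = 1.
Proof.
have mD := @shs_delays_measurable _ H s.
have DR : delays s `<=` Rplus by move=> tau [e _ [s' [s'' [? _ _] _]]].
rewrite /shs_kernel /= /shs_kappa /kappa.
rewrite (_ : Rplus = delays s `|` (Rplus `\` delays s)); last first.
  by rewrite setDUK.
have mN : measurable (Rplus `\` delays s) by exact: measurableD.
rewrite ge0_integral_setU//=; last 2 first.
  - by rewrite setDUK//; exact: shs_integrand_measurable.
  - by rewrite disj_set2E setDE setICA setICr setI0.
rewrite [X in _ + X](_ : _ = 0) ?adde0; last first.
  apply: null_set_integral => //.
    by apply: measurable_funS (@shs_integrand_measurable _ H s _ measurableT).
  apply/eqP; rewrite eq_le measure_ge0 andbT.
  rewrite -[leRHS](_ : shs_mu s (~` delays s) = 0); last first.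
    by rewrite probability_setC// shs_mu_delays subee.
  by apply: le_measure; rewrite ?inE//; exact: measurableC.
rewrite (eq_integral (cst 1)); last by move=> tau /set_mem; exact: integrandT.
by rewrite integral_cst// mul1e; exact: shs_mu_delays.
Qed.

HB.instance Definition _ :=
  Kernel_isProbability.Build _ _ _ _ _ shs_kernel kernelT.

Definition induced_sts : sts R := STS shs_kernel.

End induced_sts.

Section cycle_reset.
Context (R : realType) (H : shs R).

Definition strongly_reset (e : edge H) : Prop :=
  exists (reset' : set (vec_space H)) (eta' : probability (vec_space H) R),
    [/\ measurable reset', eta' reset' = 1 &
        forall v, hs_guard e v ->
          hs_reset e v = reset' /\
          (forall A, measurable A -> shs_eta e v A = eta' A)].

(** A simple cycle is given by the sequence of its edges. *)
Definition simple_cycle (c : seq (edge H)) : bool :=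
  [&& c != [::], all (mem (hs_edges H)) c,
      cycle (fun e e' => target e == source e') c & uniq (map (@source _ H) c)].

Definition cycle_reset : Prop :=
  forall c, simple_cycle c -> exists2 e, e \in c & strongly_reset e.

End cycle_reset.

(* Main.v *)
Require Import Defs.
From HB Require Import structures.
From mathcomp Require Import all_boot all_order all_algebra.
From mathcomp Require Import all_classical all_reals all_analysis measurable_realfun.

(** Qualitative bisimulation: a measurable map [alpha] onto a finite set is an
    abstraction as soon as the positivity of [kappa(s, alpha^-1 A)] depends on
    [alpha s] only; one may then take for [kappa_2 q] the image under [alpha] of
    [kappa s] for any [s] in the class [q]. Such an [alpha] is found by refining the
    partition given by [B] and the locations with the sets
    [pre P = {s | kappa(s, P) > 0}]. Edges that are not strongly reset form an acyclic
    graph, so they decrease a rank on locations; between locations where the rank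
    does not decrease all edges are strongly reset, and [pre] then takes only
    finitely many values. Hence refinement, done by increasing rank, terminates.

    Soundness: let [Q] be the set of states whose class reaches [C] almost surely. In
    [Q], [alpha^-1 C] is reached with positive probability within some number of
    steps. This probability is made uniform by the strongly reset edges: for [n]
    large, each of the finitely many reset laws gives mass at least 1/2 to the states
    that lie outside [Q] or where it is at least [1/(n+1)] within [n] steps, and every
    path takes a strongly reset edge within boundedly many steps. As [Q] is almost surely never left before
    [alpha^-1 C] is reached, the probability of avoiding [alpha^-1 C] decays
    geometrically. *)

Set Implicit Arguments.
Unset Strict Implicit.
Unset Printing Implicit Defensive.
Import Order.TTheory GRing.Theory Num.Theory.
Import numFieldNormedType.Exports.

Local Open Scope classical_set_scope.
Local Open Scope ring_scope.
Local Open Scope ereal_scope.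

(** * Integrals of nonnegative functions *)

Section integral_positivity.
Context d (T : measurableType d) (R : realType).
Implicit Types (m : {measure set T -> \bar R}) (D A : set T) (f g : T -> \bar R).

Lemma measurable_gt0 D f : measurable D -> measurable_fun D f ->
  measurable (D `&` [set x | 0 < f x]).
Proof. by move=> mD mf; exact: emeasurable_fun_o_infty. Qed.

Lemma integral_gt0P m D f : measurable D -> measurable_fun D f ->
  (forall x, D x -> 0 <= f x) ->
  0 < \int[m]_(x in D) f x <-> 0 < m (D `&` [set x | 0 < f x]).
Proof.
move=> mD mf f0; have mP := measurable_gt0 mD mf.
suff : \int[m]_(x in D) f x = 0 <-> m (D `&` [set x | 0 < f x]) = 0.
  move=> [h1 h2]; rewrite !lt0e measure_ge0 integral_ge0// !andbT.
  by split=> /eqP h; apply/eqP; [move=> /h2|move=> /h1].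
rewrite (_ : \int[m]_(x in D) f x = \int[m]_(x in D) `|f x|); last first.
  apply: eq_integral => x /set_mem Dx; rewrite gee0_abs// f0//.
rewrite ae_eq_integral_abs// -negligibleP//.
rewrite /ae_eq /prop_near1 /nbhs/= /almost_everywhere.
suff -> : ~` [set x | D x -> f x = cst 0 x] = D `&` [set x | 0 < f x] by [].
apply/seteqP; split=> x /=.
  move=> /not_implyP[Dx fx]; split=> //.
  by rewrite lt0e f0// andbT; apply/eqP.
by move=> [Dx fx] /(_ Dx) fx0; move: fx; rewrite fx0 ltxx.
Qed.

(** Qualitative equivalence compares only positivity, and for a fixed measure the positivity of an
    integral depends only on where the integrand is positive. *)
Lemma integral_gt0_ext m D f g : measurable D ->
  measurable_fun D f -> measurable_fun D g ->
  (forall x, D x -> 0 <= f x) -> (forall x, D x -> 0 <= g x) ->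
  (forall x, D x -> 0 < f x <-> 0 < g x) ->
  0 < \int[m]_(x in D) f x <-> 0 < \int[m]_(x in D) g x.
Proof.
move=> mD mf mg f0 g0 fg; rewrite !integral_gt0P//.
suff -> : D `&` [set x | 0 < f x] = D `&` [set x | 0 < g x] by [].
by apply/seteqP; split=> x [Dx] /= /(fg x Dx).
Qed.

(** Serves to confine one-step integrals to the almost surely invariant set on which avoidance
    bounds are available. *)
Lemma ge0_integral_conull m D Q f : measurable D -> measurable Q ->
  measurable_fun D f -> (forall x, D x -> 0 <= f x) -> m (~` Q) = 0 ->
  \int[m]_(x in D) f x = \int[m]_(x in D `&` Q) f x.
Proof.
move=> mD mQ mf f0 Q0.
have mDQ : measurable (D `&` Q) by exact: measurableI.
have mDnQ : measurable (D `\` Q) by exact: measurableD.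
have DQ0 : m (D `\` Q) = 0.
  apply/eqP; rewrite eq_le measure_ge0 andbT -Q0.
  apply: le_measure; rewrite ?inE; [by []|exact: measurableC|by move=> t []].
rewrite -[X in integral _ X _](setUIDK D Q).
rewrite (ge0_integral_setU m mDQ mDnQ) ?setUIDK//; last first.
  by apply/disj_setPS => t [[_ Qt] [_ nQt]].
rewrite (null_set_integral _ _ DQ0) ?adde0//.
exact: measurable_funS mf.
Qed.

Lemma measure_finite_cover_gt0 (I : finType) m A (F : I -> set T) :
  measurable A -> (forall i, measurable (F i)) -> A `<=` \bigcup_i F i ->
  0 < m A -> exists i, 0 < m (F i).
Proof.
move=> mA mF AF A0; apply: contrapT => nF.
have F0 i : m (F i) = 0.
  apply/eqP/negPn/negP => Fi; apply: nF; exists i.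
  by rewrite lt0e Fi measure_ge0.
have : m A <= 0.
  have := @content_sub_fsum _ _ _ m I setT A F (@finite_finset _ _)
    (fun i _ => mF i) mA AF.
  by rewrite fsbig1 => [h|i _]; [exact: h|exact: F0].
by rewrite leNgt A0.
Qed.

End integral_positivity.

(** * Functions with values in [0, 1] integrated against a probability measure *)

Section subprobability_integral.
Context d (T : measurableType d) (R : realType) (m : {measure set T -> \bar R}).
Hypothesis mT : m setT = 1.
Variables (D : set T) (f : T -> \bar R).
Hypotheses (mD : measurable D) (mf : measurable_fun setT f).
Hypotheses (f0 : forall x, 0 <= f x) (f1 : forall x, f x <= 1).

(** The defect of [f] from 1, counted as 1 off [D]. Its integral complements that of [f] over [D] to
    1, so upper bounds on the latter become lower bounds on a nonnegative integral. *)
Let g x := 1 - (f \_ D) x.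

Let fD0 x : 0 <= (f \_ D) x.
Proof. by rewrite patchE; case: ifP. Qed.

Let fD1 x : (f \_ D) x <= 1.
Proof. by rewrite patchE; case: ifP. Qed.

Let mfD : measurable_fun setT (f \_ D).
Proof. by apply/(measurable_restrictT f mD); exact: measurable_funTS. Qed.

Let g0 x : 0 <= g x.
Proof.
by rewrite /g sube_ge0// fin_numElt (lt_le_trans _ (fD0 x))// (le_lt_trans (fD1 x)) ?ltry.
Qed.

Let mg : measurable_fun setT g.
Proof. exact: emeasurable_funB. Qed.

Let integralDg : \int[m]_(x in D) f x + \int[m]_x g x = 1.
Proof.
rewrite integral_mkcond -ge0_integralD//.
rewrite (eq_integral (cst 1)) ?integral_cst ?mul1e//.
move=> x _; rewrite /g addeC subeK// fin_numElt.
by rewrite (lt_le_trans _ (fD0 x))// (le_lt_trans (fD1 x)) ?ltry.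
Qed.

Lemma subprob_integral_ge0 : 0 <= \int[m]_(x in D) f x.
Proof. exact: integral_ge0. Qed.

Lemma subprob_integral_le1 : \int[m]_(x in D) f x <= 1.
Proof. by rewrite -integralDg leeDl// integral_ge0. Qed.

Let lt1E : [set x | D x -> f x < 1] = setT `&` [set x | 0 < g x].
Proof.
rewrite setTI; apply/seteqP; split=> x /=; rewrite /g sube_gt0 patchE.
  by case: ifPn => [/set_mem Dx /(_ Dx)//|]; rewrite lte01.
by case: ifPn => // nD _ Dx; move: nD; rewrite mem_set.
Qed.

Lemma subprob_measurable_lt1 : measurable [set x | D x -> f x < 1].
Proof. by rewrite lt1E; exact: measurable_gt0. Qed.

Lemma subprob_integral_lt1 :
  \int[m]_(x in D) f x < 1 <-> 0 < m [set x | D x -> f x < 1].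
Proof.
rewrite lt1E -integral_gt0P// -[X in _ < X]integralDg.
have fin : \int[m]_(x in D) f x \is a fin_num.
  by rewrite ge0_fin_numE ?subprob_integral_ge0// (le_lt_trans subprob_integral_le1) ?ltry.
by rewrite lteDl.
Qed.

(** On [A] the defect [g] is at least [e]: by assumption inside [D], and because [e <= 1] outside.
    So its integral is at least [e * c]. *)
Lemma subprob_integral_le (c e : R) (A : set T) : (0 <= e <= 1)%R -> measurable A ->
  c%:E <= m A -> (forall x, A x -> D x -> f x <= (1 - e)%:E) ->
  \int[m]_(x in D) f x <= (1 - e * c)%:E.
Proof.
move=> /andP[e0 e1] mA cA fA.
have eg : (e * c)%:E <= \int[m]_x g x.
  rewrite EFinM; apply: (@le_trans _ _ (e%:E * m A)); first by rewrite lee_wpmul2l.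
  rewrite -[A in leLHS](setIT A) -integral_indic// -ge0_integralZl//; first last.
  - exact/measurable_EFinP.
  apply: ge0_le_integral => //.
  - by move=> x _; rewrite mule_ge0// lee_fin.
  - by apply: measurable_funeM; exact/measurable_EFinP.
  move=> x _; rewrite indicE; have [/set_mem Ax|] := boolP (x \in A); last by rewrite mule0.
  rewrite mule1 /g patchE; case: ifPn => [/set_mem Dx|_].
    have := fA x Ax Dx; have := f0 x; case: (f x) => // r _.
    by rewrite -EFinB !lee_fin => h; rewrite lerBrDl -lerBrDr.
  by rewrite sube0 lee_fin.
rewrite EFinB -[X in _ <= X - _]integralDg.
apply: (@le_trans _ _ (\int[m]_(x in D) f x + ((e * c)%:E - (e * c)%:E))).
  by rewrite subee// adde0.
by rewrite addeA leeB// leeD2l.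
Qed.

End subprobability_integral.

(** * Avoiding a set *)

Section avoidance.
Context (R : realType) (T : sts R).
Notation k := (sts_kernel T).
Variable D : set T.
Hypothesis mD : measurable D.

(** The starting state [s] is not itself tested against [D]; hence the integrals over [D] in what
    follows. *)
Definition avoid n (s : T) : \bar R := path_prob (nseq n D) s.

Lemma avoid_ge0 n s : 0 <= avoid n s.
Proof.
case: n => [|n]; rewrite /avoid/=; first exact: lee01.
elim: n s => [|n IH] s /=; first by apply: integral_ge0.
by apply: integral_ge0 => x _; exact: IH.
Qed.

Lemma measurable_avoid n : measurable_fun setT (avoid n).
Proof.
elim: n => [|n IH]; first exact: measurable_cst.
rewrite (_ : avoid n.+1 = fun s => \int[k s]_t (avoid n \_ D) t); last first.
  by apply/funext => s; rewrite /avoid/= integral_mkcond.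
apply: measurable_fun_integral_kernel.
- by move=> U mU; exact: measurable_kernel.
- by move=> s; rewrite patchE; case: ifP => _; [exact: avoid_ge0|exact: lexx].
- by apply/(measurable_restrictT _ mD); exact: measurable_funTS.
Qed.

Let mavoid n (A : set T) : measurable_fun A (avoid n).
Proof. by apply: measurable_funTS; exact: measurable_avoid. Qed.

Lemma avoid_le1 n s : avoid n s <= 1.
Proof.
elim: n s => [//|n IH] s; apply: subprob_integral_le1 => //.
- exact: prob_kernel.
- exact: measurable_avoid.
- exact: avoid_ge0.
Qed.

Lemma avoid_fin_num n s : avoid n s \is a fin_num.
Proof.
by rewrite ge0_fin_numE ?avoid_ge0// (le_lt_trans (avoid_le1 _ _)) ?ltry.
Qed.

Lemma avoidS_le n s : avoid n.+1 s <= avoid n s.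
Proof.
elim: n s => [|n IH] s; first exact: avoid_le1.
apply: ge0_le_integral => //.
- by move=> x _; exact: (avoid_ge0 n.+1).
- exact: (mavoid n.+1).
- exact: (mavoid n).
- by move=> x _; exact: IH.
Qed.

Lemma avoid_le n n' s : (n <= n')%N -> avoid n' s <= avoid n s.
Proof.
move=> /subnK <-; elim: (n' - n)%N => [//|i IH].
by rewrite addSn (le_trans (avoidS_le _ _)).
Qed.

(** Markov property: the first [m] steps stay in [D] with probability [avoid m s], almost surely
    without leaving [Q], and the remaining [n] steps contribute a factor of at most [c]. *)
Lemma avoidD_le (Q : set T) (c : \bar R) m n : measurable Q ->
  0 <= c ->
  (forall s, Q s -> D s -> k s (~` Q) = 0) ->
  (forall s, Q s -> D s -> avoid n s <= c) ->
  forall s, Q s -> D s -> avoid (m + n) s <= c * avoid m s.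
Proof.
move=> mQ c0 kQ unc; elim: m => [|m IH] s Qs Ds.
  by rewrite add0n [avoid 0 _]/avoid/= mule1 unc.
rewrite addSn /avoid/= -!/(avoid _ _).
have mDQ : measurable (D `&` Q) by exact: measurableI.
rewrite (ge0_integral_conull mD mQ (@mavoid _ _) _ (kQ s Qs Ds)); last first.
  by move=> t _; exact: avoid_ge0.
rewrite -ge0_integralZl//; [|exact: mavoid|by move=> t _; exact: avoid_ge0].
have mcu (A : set T) : measurable_fun A (fun t => c * avoid m t).
  by apply: emeasurable_funM; [exact: measurable_cst|exact: mavoid].
apply: (@le_trans _ _ (\int[k s]_(t in D `&` Q) (c * avoid m t))).
  apply: ge0_le_integral => //.
  - by move=> t _; exact: avoid_ge0.
  - by move=> t [Dt Qt]; exact: IH.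
by apply: ge0_subset_integral => // t _; rewrite mule_ge0// avoid_ge0.
Qed.

Lemma measurable_coordinate i (A : set T) : measurable A ->
  measurable [set w : runs T | A (w i)].
Proof.
move=> mA; apply: sub_sigma_algebra; exists i => //; exists A => //.
by rewrite setTI.
Qed.

Lemma is_run_measure_avoid (mu : probability T R) (P : probability (runs T) R) n :
  is_run_measure mu P ->
  P [set w | forall i, (i <= n)%N -> D (w i)] = \int[mu]_(s in D) avoid n s.
Proof.
move=> /(_ D (nseq n D) mD) <-.
  (* Past the end of the list [nth] returns [setT], which imposes no condition. *)
  congr (P _); apply/seteqP; split=> w h i.
    case: i => [|i] /=; first exact: h.
    by rewrite nth_nseq; case: ifP => // ?; exact: h.
  move=> ni; have := h i; case: i ni => [//|i] ni /=.
  by rewrite nth_nseq ni.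
by move=> i; rewrite nth_nseq; case: ifP.
Qed.

End avoidance.

(** * Almost sure reachability *)

Section reachability.
Context (R : realType) (T : sts R).
Variable C : set T.
Hypothesis mC : measurable C.

Let F n : set (runs T) := [set w | forall i, (i <= n)%N -> (~` C) (w i)].

Let mF n : measurable (F n).
Proof.
rewrite (_ : F n = \bigcap_(i in [set i | (i <= n)%N]) [set w | (~` C) (w i)]).
  apply: bigcap_measurable; first by exists 0%N.
  by move=> i _; apply: measurable_coordinate; exact: measurableC.
by apply/seteqP; split=> w h i; exact: h.
Qed.

Let capF : \bigcap_n F n = ~` reach C.
Proof.
apply/seteqP; split=> w h.
  by move=> [i Ci]; exact: (h i Logic.I i).
by move=> n _ i _ Ci; apply: h; exists i.
Qed.

Lemma measurable_reach : measurable (reach C).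
Proof.
rewrite -[reach C]setCK -capF; apply: measurableC.
by apply: bigcap_measurable => //; exists 0%N.
Qed.

(** The events [F n] decrease to the complement of [reach C], so continuity from above applies. The
    criterion involves only the kernel and the initial law. *)
Lemma reach_eq1P (mu : probability T R) (P : probability (runs T) R) :
  is_run_measure mu P ->
  P (reach C) = 1 <->
  forall e : R, (0 < e)%R -> exists n, \int[mu]_(s in ~` C) avoid (~` C) n s < e%:E.
Proof.
move=> muP; have mR := measurable_reach.
have PF n : P (F n) = \int[mu]_(s in ~` C) avoid (~` C) n s.
  by apply: is_run_measure_avoid => //; exact: measurableC.
have -> : P (reach C) = 1 <-> P (~` reach C) = 0.
  rewrite probability_setC//; split=> [->|]; first by rewrite subee.
  have : P (reach C) \is a fin_num by exact: fin_num_measure.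
  case: (P (reach C)) => // r _ /eqP; rewrite -EFinB eqe subr_eq0 => /eqP <- //.
have cvF : P \o F @ \oo --> P (~` reach C).
  rewrite -capF; apply: nonincreasing_cvg_mu => //.
  - by rewrite (le_lt_trans (probability_le1 _ _)) ?ltry.
  - by rewrite capF; exact: measurableC.
  - by move=> n m nm; apply/subsetPset => w h i im; apply: h; exact: leq_trans im nm.
split=> [P0 e e0|h].
  apply: contrapT => /forallNP nlt.
  have : e%:E <= P (~` reach C).
    rewrite -(cvg_lim _ cvF)//; apply: lime_ge.
      by apply/cvg_ex; eexists; exact: cvF.
    by apply: nearW => n /=; rewrite PF leNgt; apply/negP; exact: nlt.
  by rewrite P0 lee_fin leNgt e0.
apply/eqP; rewrite eq_le measure_ge0 andbT; apply/lee_addgt0Pr => e e0.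
have [n hn] := h e e0; rewrite add0e (le_trans _ (ltW hn))// -PF.
apply: le_measure; rewrite ?inE//; first exact: measurableC.
by rewrite -capF; exact: bigcap_inf.
Qed.

End reachability.

(** * Soundness from a uniform attraction property *)

Section soundness.
Context (R : realType) (T1 T2 : sts R) (alpha : {mfun T1 >-> T2}).
Notation k1 := (sts_kernel T1).
Notation k2 := (sts_kernel T2).
Hypothesis mT2 : forall A : set T2, measurable A.
Hypothesis k12 : forall s A, 0 < k1 s (alpha @^-1` A) <-> 0 < k2 (alpha s) A.

Let malpha (A : set T2) : measurable (alpha @^-1` A).
Proof. by rewrite -[X in measurable X]setTI; exact: measurable_funPT. Qed.

Lemma kernel_bisimulation_abstraction : is_abstraction alpha.
Proof.
move=> mu A _; rewrite /pushforward /Omega.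
rewrite ge0_integral_distribution//.
apply: integral_gt0_ext => //.
- exact: (measurable_kernel k1 _ (malpha A)).
- exact: (measurableT_comp (measurable_kernel k2 A (mT2 A)) (measurable_funPT alpha)).
Qed.

(** Iterated from [X], this gives a set from each point of which [X] is reached
    with a probability bounded away from 0; 1/2 plays no special role. *)
Definition attract (T : sts R) (X : set T) : set T :=
  X `|` [set t | (2^-1)%:E <= sts_kernel T t X].

Lemma measurable_attract (T : sts R) (X : set T) :
  measurable X -> measurable (attract X).
Proof.
move=> mX; apply: measurableU => //; rewrite -[X in measurable X]setTI.
by apply: emeasurable_fun_c_infty => //; exact: measurable_kernel.
Qed.

(** Abstracts what cycle-reset provides: bounds that hold state by state, once collected in an
    exhausting sequence, become uniform after [r] rounds. *)
Hypothesis attraction : exists r, forall A : nat -> set T1,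
  (forall n, measurable (A n)) -> (forall n m, (n <= m)%N -> A n `<=` A m) ->
  \bigcup_n A n = setT -> exists n, iter r (@attract T1) (A n) = setT.

Section target.
Variable C : set T2.
Let D1 := ~` (alpha @^-1` C).
Let u1 := avoid D1.
Let u2 := avoid (~` C).
Let mD1 : measurable D1. Proof. exact: measurableC. Qed.
Let mu1 n A : measurable_fun A (u1 n).
Proof. by apply: measurable_funTS; exact: measurable_avoid. Qed.
Let mf2 A (f : T2 -> \bar R) : measurable_fun A f.
Proof. by move=> _ Y _; exact: mT2. Qed.

(** The states from which [C] is reached almost surely. *)
Let W : set T2 := [set q | C q \/ forall e : R, (0 < e)%R -> exists n, u2 n q < e%:E].

(** Outside [W] the infimum [v] of the avoidance probabilities is positive. If [W] were not conull,
    the integral of [v] would be a positive lower bound for the integrals of all [u2 n]. *)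
Let conull_W (m : {measure set T2 -> \bar R}) : m setT = 1 ->
  (forall e : R, (0 < e)%R -> exists n, \int[m]_(q in ~` C) u2 n q < e%:E) ->
  m (~` W) = 0.
Proof.
move=> mT h; apply/eqP/negPn/negP => W0.
pose v q := ereal_inf (range (u2 ^~ q)).
have vu n q : v q <= u2 n q by apply: ereal_inf_lbound; exists n.
have v0 q : 0 <= v q by apply: le_ereal_inf_tmp => _ [n _ <-]; exact: avoid_ge0.
have vpos : 0 < \int[m]_(q in ~` C) v q.
  apply/integral_gt0P => //.
  rewrite (_ : _ `&` _ = ~` W) ?lt0e ?W0 ?measure_ge0//.
  apply/seteqP; split=> q.
    move=> [nC vq] [//|/(_ (fine (v q)))].
    have vfin : v q \is a fin_num.
      by rewrite ge0_fin_numE// (le_lt_trans (vu 0%N q))// (le_lt_trans (avoid_le1 _ _ _)) ?ltry.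
    rewrite fine_gt0 ?vq /= ?(le_lt_trans (vu 0%N q)) ?(le_lt_trans (avoid_le1 _ _ _)) ?ltry//.
    by move=> /(_ isT)[n]; rewrite fineK// ltNge vu.
  move=> nW; have nC : ~ C q by move=> Cq; apply: nW; left.
  split=> //=; apply: contrapT => vq; apply: nW; right => e e0.
  have : v q < e%:E by rewrite (@le_lt_trans _ _ 0) ?lte_fin// leNgt; exact/negP.
  by move=> /ereal_inf_lt[_ [n _ <-]] ?; exists n.
have vle n : \int[m]_(q in ~` C) v q <= \int[m]_(q in ~` C) u2 n q.
  by apply: ge0_le_integral => //; exact: mf2.
have vfin : \int[m]_(q in ~` C) v q < +oo.
  have [n hn] := h 1%R ltr01.
  by rewrite (le_lt_trans (vle n))// (lt_trans hn) ?ltry.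
have /h[n] : (0 < fine (\int[m]_(q in ~` C) v q))%R by rewrite fine_gt0// vpos.
rewrite fineK ?ge0_fin_numE//; last exact: ltW.
by rewrite ltNge vle.
Qed.

(** [u2 n.+1 q] is the integral of [u2 n] against [k2 q], so [conull_W] applies to the measure
    [k2 q]. *)
Let k2_W q : W q -> ~ C q -> k2 q (~` W) = 0.
Proof.
move=> [//|h] nC; apply: conull_W => [|e /h[n hn]]; first exact: prob_kernel.
by exists n; apply: le_lt_trans hn; exact: avoidS_le.
Qed.

Let Q := alpha @^-1` W.

Let k1_Q s : Q s -> D1 s -> k1 s (~` Q) = 0.
Proof.
move=> Qs Ds; apply/eqP; rewrite eq_le measure_ge0 andbT leNgt; apply/negP.
by move=> /(k12 s (~` W)); rewrite (k2_W Qs) ?ltxx.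
Qed.

(** Probabilities do not transfer along [alpha], but being below 1 does: by [subprob_integral_lt1]
    it says that a set has positive mass, which [k12] preserves. *)
Let u12_lt1 n s : u2 n (alpha s) < 1 -> u1 n s < 1.
Proof.
elim: n s => [//|n IH] s.
move=> /(@subprob_integral_lt1 _ _ _ (k2 (alpha s)) (prob_kernel _) (~` C) (u2 n)
  (mT2 _) (mf2 _) (avoid_ge0 _ _) (avoid_le1 (mT2 _) _)).
rewrite -k12 => h.
apply/(@subprob_integral_lt1 _ _ _ (k1 s) (prob_kernel _) D1 (u1 n)
  mD1 (@mu1 _ _) (avoid_ge0 _ _) (avoid_le1 mD1 _)).
apply: (lt_le_trans h); apply: le_measure; rewrite ?inE//.
  by apply: subprob_measurable_lt1.
by move=> t /= ht Dt; apply: IH; exact: ht.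
Qed.

(** Outside [Q] and on the target there is nothing to bound. Elsewhere [n] serves both as time
    horizon and as quality of the bound, which makes the sequence increasing. *)
Let A n : set T1 := ~` Q `|` ~` D1 `|` [set t | u1 n t <= (1 - n.+1%:R^-1)%:E].

Let mA n : measurable (A n).
Proof.
apply: measurableU.
  by apply: measurableU; apply: measurableC => //; exact: malpha.
rewrite -[X in measurable X]setTI.
by apply: emeasurable_fun_infty_c => //; exact: mu1.
Qed.

Let A_nondecreasing n m : (n <= m)%N -> A n `<=` A m.
Proof.
move=> nm t [?|/= h]; [by left|right=> /=].
apply: (le_trans (avoid_le mD1 t nm)); apply: (le_trans h).
by rewrite lee_fin lerB// lef_pV2 ?posrE// ler_nat.
Qed.

Let A_cover : \bigcup_n A n = setT.
Proof.
apply/seteqP; split=> // t _.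
have [|nQ] := pselect (Q t); last by exists 0%N => //; left; left.
have [nD _|Dt] := pselect (~ D1 t); first by exists 0%N => //; left; right.
move: Dt => /contrapT Dt; move=> [//|/(_ 1%R ltr01)[n /u12_lt1 un]].
have ufin : u1 n t \is a fin_num by exact: avoid_fin_num.
have : (0 < 1 - fine (u1 n t))%R by rewrite subr_gt0 -lte_fin fineK.
(* [m] is such that 1/(m+1) lies below the gap; the maximum with [n] suits both roles of the
   index. *)
move=> /ltr_add_invr [m]; rewrite add0r => hm.
exists (maxn n m) => //; right => /=.
apply: (@le_trans _ _ (u1 n t)); first by apply: avoid_le => //; exact: leq_maxl.
rewrite -(fineK ufin) lee_fin lerBrDl -lerBrDr (le_trans _ (ltW hm))//.
by rewrite lef_pV2 ?posrE// ler_nat ltnS leq_maxr.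
Qed.

(** Each round of [attract] costs one more step and halves the guaranteed probability of hitting the
    target: with probability at least 1/2 the next state lies in the previous iterate, and almost
    surely it is in [Q]. *)
Let u1_attract n r t : iter r (@attract T1) (A n) t -> Q t -> D1 t ->
  u1 (n + r) t <= (1 - n.+1%:R^-1 * 2^-1 ^+ r)%:E.
Proof.
have mG i : measurable (iter i (@attract T1) (A n)).
  by elim: i => [|i IH]; [exact: mA|exact: measurable_attract].
have e01 i : (0 <= (n.+1%:R^-1 * 2^-1 ^+ i : R) <= 1)%R.
  rewrite mulr_ge0 ?exprn_ge0//= mulr_ile1// ?exprn_ge0// ?exprn_ile1//.
    by rewrite invf_le1// ler1n.
  by rewrite invf_le1// ler1n.
elim: r t => [|r IH] t /=.
  by move=> [[//|//]|/= h] Qt Dt; rewrite addn0 expr0 mulr1.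
move=> [h|/= h] Qt Dt.
  rewrite addnS (le_trans (avoidS_le mD1 _ _))// (le_trans (IH t h Qt Dt))//.
  rewrite lee_fin lerB// exprS ler_wpM2l// ler_piMl ?exprn_ge0//.
  by rewrite invf_le1// ler1n.
rewrite addnS exprSr mulrA.
rewrite [u1 _ _]/u1 /avoid/= -/(avoid _ _).
rewrite (ge0_integral_conull mD1 (malpha W) (@mu1 _ _) _ (k1_Q Qt Dt)); last first.
  by move=> x _; exact: avoid_ge0.
apply: (subprob_integral_le _ _ _ _ _ _ (mG r) h) => //.
- exact: prob_kernel.
- exact: measurableI.
- exact: avoid_ge0.
- exact: avoid_le1.
- by move=> x Gx [Dx Qx]; exact: IH.
Qed.

Lemma kernel_bisimulation_reach (mu : probability T1 R)
    (P1 : probability (runs T1) R) (P2 : probability (runs T2) R) :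
  is_run_measure mu P1 -> is_run_measure (distribution mu alpha) P2 ->
  P2 (reach C) = 1 -> P1 (reach (alpha @^-1` C)) = 1.
Proof.
move=> muP1 muP2 /(reach_eq1P (mT2 C) muP2) h.
(* [h] is exactly the premise of [conull_W] for the image law on [T2]. *)
have muQ : mu (~` Q) = 0.
  have := @conull_W (distribution mu alpha).
  by apply => //; exact: probability_setT.
have [r /(_ A mA A_nondecreasing A_cover)[n An]] := attraction.
pose rho : R := (1 - n.+1%:R^-1 * 2^-1 ^+ r)%R.
have rho1 : (rho < 1)%R.
  by rewrite /rho ltrBlDr ltrDl mulr_gt0// exprn_gt0.
have urho s : Q s -> D1 s -> u1 (n + r) s <= rho%:E.
  by apply: u1_attract; rewrite An.
have rho0 : (0 <= rho)%R.
  rewrite /rho subr_ge0 mulr_ile1// ?exprn_ge0// ?exprn_ile1//.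
    by rewrite invf_le1// ler1n.
  by rewrite invf_le1// ler1n.
(* Time is cut into [j] blocks of [n + r] steps, each costing a factor [rho]. *)
have ugeo j s : Q s -> D1 s -> u1 (j * (n + r)) s <= (rho ^+ j)%:E.
  elim: j s => [|j IH] s Qs Ds; first by rewrite mul0n expr0 avoid_le1.
  rewrite mulSn exprSr EFinM.
  have := @avoidD_le _ _ _ mD1 Q (rho ^+ j)%:E (n + r) (j * (n + r)) (malpha W) _ k1_Q IH s Qs Ds.
  move=> /(_ _)/le_trans; apply; first by rewrite lee_fin exprn_ge0.
  by rewrite lee_wpmul2l ?lee_fin ?exprn_ge0// urho.
apply/(reach_eq1P (malpha C) muP1) => e e0.
have [j hj] : exists j, (rho ^+ j < e)%R.
  have : (fun i => rho ^+ i)%R @ \oo --> (0 : R)%R by apply: cvg_expr; rewrite ger0_norm.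
  by move=> /cvgr_lt/(_ e e0)[j _ /(_ j (leqnn j))]; exists j.
exists (j * (n + r))%N; apply: (@le_lt_trans _ _ (rho ^+ j)%:E); last by rewrite lte_fin.
rewrite (ge0_integral_conull mD1 (malpha W) (@mu1 _ _) _ muQ); last first.
  by move=> x _; exact: avoid_ge0.
have mDQ : measurable (D1 `&` Q) := measurableI _ _ mD1 (malpha W).
apply: (@le_trans _ _ (\int[mu]_(s in D1 `&` Q) (rho ^+ j)%:E)).
  apply: ge0_le_integral => //.
  - by move=> x _; exact: avoid_ge0.
  - by move=> s [Ds Qs]; exact: ugeo.
rewrite integral_cst// -[leRHS]mule1 lee_wpmul2l ?lee_fin ?exprn_ge0//.
exact: probability_le1.
Qed.

End target.

Lemma kernel_bisimulation_sound : is_sound_abstraction alpha.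
Proof.
split; first exact: kernel_bisimulation_abstraction.
by move=> mu C _ P1 P2; exact: kernel_bisimulation_reach.
Qed.

End soundness.

(** * Finite refinement *)

Section finite_families.
Context d (T : measurableType d).
Implicit Types (F : set (set T)) (P : set T).

(** [P] is a union of atoms of the algebra of sets generated by [F]. *)
Definition saturated F P : Prop :=
  forall s t, (forall G, F G -> G s <-> G t) -> P s -> P t.

Lemma saturated_mem F G : F G -> saturated F G.
Proof. by move=> FG s t /(_ G FG)[]. Qed.

Lemma saturated_bigcup F (I : Type) (P : I -> set T) :
  (forall i, saturated F (P i)) -> saturated F (\bigcup_i P i).
Proof. by move=> h s t st [i _ /(h i s t st)]; exists i. Qed.

(** The atom of [s], coded in a finite type that will be the abstract state space; some codes may
    belong to no state. *)
Definition type_of (Gs : seq (set T)) (s : T) : {ffun 'I_(size Gs) -> bool} :=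
  [ffun i : 'I_(size Gs) => `[< nth set0 Gs i s >]].

Lemma type_of_eqP (Gs : seq (set T)) s t :
  type_of Gs s = type_of Gs t <-> (forall G, G \in Gs -> G s <-> G t).
Proof.
split=> [/ffunP st G /(nthP set0)[i ilt <-]|st].
  by have := st (Ordinal ilt); rewrite !ffunE/= => h; exact: asbool_eq_equiv h.
by apply/ffunP => i; rewrite !ffunE; apply/asbool_equiv_eq/st; exact: mem_nth.
Qed.

Lemma saturated_type_of (Gs : seq (set T)) P : saturated [set` Gs] P ->
  P = type_of Gs @^-1` (type_of Gs @` P).
Proof.
move=> satP; apply/seteqP; split=> [s Ps|s [t Pt ts]]; first by exists s.
by apply: (satP t s) => // G /= GGs; exact: ((type_of_eqP Gs t s).1 ts G GGs).
Qed.

Lemma measurable_type_of_preimage (Gs : seq (set T)) Y :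
  (forall G, G \in Gs -> measurable G) -> measurable (type_of Gs @^-1` Y).
Proof.
move=> mGs.
rewrite (_ : _ @^-1` _ = \bigcup_(y in Y) type_of Gs @^-1` [set y]); last first.
  by apply/seteqP; split=> [s Ys|s [y Yy /= sy]]; [exists (type_of Gs s)|rewrite /= sy].
apply: fin_bigcup_measurable; first exact: finite_finset.
move=> y _; rewrite (_ : _ @^-1` _ = \bigcap_(i in [set: 'I_(size Gs)])
    [set s | `[< nth set0 Gs i s >] = y i]); last first.
  apply/seteqP; split=> s.
    by move=> /= <- i _ /=; rewrite ffunE.
  by move=> h; apply/ffunP => i; rewrite ffunE; exact: h.
apply: fin_bigcap_measurable; first exact: finite_finset.
move=> i _; have mG : measurable (nth set0 Gs i) by apply: mGs; exact: mem_nth.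
case: (y i).
  suff -> : [set s | `[< nth set0 Gs i s >] = true] = nth set0 Gs i by [].
  by apply/seteqP; split=> s /asboolP.
suff -> : [set s | `[< nth set0 Gs i s >] = false] = ~` nth set0 Gs i.
  exact: measurableC.
by apply/seteqP; split=> s /= => [/asboolPn//|/asboolPn/negbTE].
Qed.

Lemma measurable_saturated F P : finite_set F -> F `<=` measurable ->
  saturated F P -> measurable P.
Proof.
move=> /finite_seqP[Gs ->] mGs /saturated_type_of ->.
exact: measurable_type_of_preimage.
Qed.

(** A saturated set is the preimage of its set of types, and there are finitely many sets of
    types. *)
Lemma finite_saturated F : finite_set F -> finite_set [set P | saturated F P].
Proof.
move=> /finite_seqP[Gs ->].
apply: (@sub_finite_set _ _ ((fun Y : {set {ffun 'I_(size Gs) -> bool}} =>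
   type_of Gs @^-1` [set y | y \in Y]) @` setT)).
  move=> P /saturated_type_of PE; exists [set y | `[< (type_of Gs @` P) y >]]%SET => //.
  rewrite [RHS]PE; apply/seteqP; split=> s /=; rewrite inE => /asboolP//.
by apply: finite_image; exact: finite_finset.
Qed.

End finite_families.

(** * Refinement by predecessor sets *)

Section refinement.
Context (R : realType) (T : sts R) (L : finType) (loc : T -> L).
Hypothesis mloc : forall l, measurable (loc @^-1` [set l]).
Implicit Types (P : set T) (F : set (set T)).

Definition pre P : set T := [set s | 0 < sts_kernel T s P].

Lemma measurable_pre P : measurable P -> measurable (pre P).
Proof.
move=> mP; rewrite -[X in measurable X]setTI.
by apply: measurable_gt0 => //; exact: measurable_kernel.
Qed.

(** Predecessors are split by source and target location because the rank compares these two. *)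
Definition pre_at l l' P : set T :=
  pre (P `&` loc @^-1` [set l']) `&` loc @^-1` [set l].

Lemma measurable_pre_at l l' P : measurable P -> measurable (pre_at l l' P).
Proof.
by move=> mP; apply: measurableI => //; apply: measurable_pre; exact: measurableI.
Qed.

Lemma pre_bigcup P : measurable P ->
  pre P = \bigcup_(ll : L * L) pre_at ll.1 ll.2 P.
Proof.
move=> mP; apply/seteqP; split=> s.
  move=> /(measure_finite_cover_gt0 (F := fun l => P `&` loc @^-1` [set l]) mP).
  move=> []; last by move=> l' h; exists (loc s, l').
  - by move=> l; exact: measurableI.
  - by move=> t Pt; exists (loc t).
move=> [[l l'] _ [/= h _]]; apply: (lt_le_trans h); apply: le_measure; rewrite ?inE//.
exact: measurableI.
Qed.

Variable rank : L -> nat.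
Hypothesis finite_pre_at : forall l l', (rank l <= rank l')%N ->
  finite_set [set pre_at l l' P | P in measurable].
Variable F0 : set (set T).
Hypotheses (finF0 : finite_set F0) (mF0 : F0 `<=` measurable).

(** All predecessor sets along pairs where the rank does not decrease are included at once, so only
    rank-decreasing pairs remain to be refined. *)
Let base : set (set T) := F0 `|` range (fun l => loc @^-1` [set l]) `|`
  \bigcup_(ll in [set ll : L * L | (rank ll.1 <= rank ll.2)%N])
    [set pre_at ll.1 ll.2 P | P in measurable].

Let refine F : set (set T) := base `|`
  \bigcup_(ll : L * L) [set pre_at ll.1 ll.2 P | P in saturated F].

Let F_ n := iter n refine base.

Let base_F n : base `<=` F_ n.
Proof. by case: n => [//|n] G; left. Qed.

Let loc_F n l : F_ n (loc @^-1` [set l]).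
Proof. by apply: base_F; left; right; exists l. Qed.

Let finite_base : finite_set base.
Proof.
rewrite !finite_setU; split; [split=> //|].
  by apply: finite_image; exact: finite_finset.
by apply: bigcup_finite => [|[l l'] /= ll]; [exact: finite_finset|exact: finite_pre_at].
Qed.

Let finite_F n : finite_set (F_ n).
Proof.
elim: n => [//|n IH] /=; rewrite finite_setU; split=> //.
apply: bigcup_finite => [|ll _]; first exact: finite_finset.
by apply: finite_image; exact: finite_saturated.
Qed.

Let measurable_base : base `<=` measurable.
Proof.
move=> G [[/mF0//|[l _ <-]//]|[ll _ [P mP <-]]]; exact: measurable_pre_at.
Qed.

Let measurable_F n : F_ n `<=` measurable.
Proof.
elim: n => [//|n IH] G /= [/measurable_base//|[ll _ [P satP <-]]].
by apply: measurable_pre_at; apply: measurable_saturated satP.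
Qed.

(** Below rank [n] the refinement is stationary after [n] steps. *)
Let saturated_F n m l P : (rank l < n <= m)%N -> saturated (F_ m) P ->
  saturated (F_ n) (P `&` loc @^-1` [set l]).
Proof.
elim: n m l P => [|n IH] [|m] l P /andP[ln nm] // satP s t st [Ps /= ls].
have lt : loc t = l by apply: (st _ (loc_F n.+1 l)).1.
suff Pt : P t by [].
apply: (satP s t _ Ps) => G /= [Gb|[[l1 l2] _ [P' satP' <-]]].
  exact: (st _ (@base_F n.+1 _ Gb)).
have [<-|ll1] := eqVneq l l1; last first.
  split=> -[_ /=]; [rewrite ls|rewrite lt] => h; by rewrite h eqxx in ll1.
have [ll2|l2l] := leqP (rank l) (rank l2).
  apply: (st (pre_at l l2 P')); apply: base_F; right; exists (l, l2) => //.
  by exists P' => //; exact: measurable_saturated satP'.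
(* Here the rank drops, so the induction hypothesis makes the part of [P'] in [l2] saturated one
   stage earlier; cutting [P'] down to [l2] does not change [pre_at l l2 P']. *)
apply: (st (pre_at l l2 P')); right; exists (l, l2) => //.
exists (P' `&` loc @^-1` [set l2]).
  by apply: IH satP'; rewrite (leq_trans l2l) //= -ltnS.
by rewrite /pre_at -setIA setIid.
Qed.

Lemma finite_pre_stable_family : exists F, [/\ finite_set F, F `<=` measurable,
  F0 `<=` F, (forall l, F (loc @^-1` [set l])) &
  forall P, saturated F P -> saturated F (pre P)].
Proof.
pose N := (\max_l rank l).+1.
have rankN l : (rank l < N)%N by rewrite ltnS leq_bigmax.
exists (F_ N); split=> //; first by move=> G ?; apply: base_F; left; left.
move=> P satP; rewrite pre_bigcup; last exact: measurable_saturated satP.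
apply: saturated_bigcup => -[l l'].
(* The predecessor set appears at stage [N.+1]; as all ranks are below [N], [saturated_F] brings it
   back to stage [N]. *)
have satN : saturated (F_ N.+1) (pre_at l l' P).
  by apply: saturated_mem; right; exists (l, l') => //; exists P.
have := @saturated_F N N.+1 l _ _ satN; rewrite rankN leqnSn => /(_ isT).
by rewrite /pre_at -setIA setIid.
Qed.

End refinement.

(** * The kernel of a stochastic hybrid system *)

Lemma finite_image_factor (A B : choiceType) (F : finType) (D : set A) (f : A -> B)
    (g : A -> F) :
  (forall x y, D x -> D y -> g x = g y -> f x = f y) -> finite_set (f @` D).
Proof.
move=> fg; have [[x0 Dx0]|] := pselect (D !=set0); last first.
  by move=> /nonemptyPn ->; rewrite image_set0; exact: finite_set0.
pose h y := f (xget x0 [set x | D x /\ g x = y]).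
apply: (@sub_finite_set _ _ (h @` setT)).
  move=> _ [x Dx <-]; exists (g x) => //; rewrite /h; case: xgetP => [x' _ [Dx' gx']|/(_ x)[]//].
  exact: fg.
by apply: finite_image; exact: finite_finset.
Qed.

(** The rank counts reachable vertices. Along [w x y] the reachable set shrinks strictly, since it
    loses [x]. *)
Lemma finType_acyclic_rank (L : finType) (w : rel L) :
  (forall x y, w x y -> ~~ connect w y x) ->
  exists rank : L -> nat, forall x y, w x y -> (rank y < rank x)%N.
Proof.
move=> acyc; exists (fun x => #|[set y | connect w x y]%SET|) => x y wxy.
apply: proper_card; apply/properP; split.
  by apply/fintype.subsetP => z; rewrite !inE => /(connect_trans (connect1 wxy)).
by exists x; rewrite inE ?connect0 ?acyc.
Qed.

Section hybrid.
Context (R : realType) (H : shs R).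
Notation edge := (hs_loc H * hs_event H * hs_loc H)%type.
Notation eta := (@shs_eta _ H).
Notation p := (@shs_p _ H).
Notation f := (kappa_integrand eta p).
Notation Rplus := [set tau : R | (0 <= tau)%R].
Notation k := (sts_kernel (induced_sts H)).
Implicit Types (s : hstate H) (e : edge) (P : set (hstate H)).

Lemma measurable_Rplus : measurable Rplus.
Proof. by rewrite -set_itvcy; exact: measurable_itv. Qed.
Local Hint Resolve measurable_Rplus : core.

Definition loc_section (P : set (hstate H)) (l : hs_loc H) : set (vec_space H) :=
  [set v | P (l, v)].

Lemma measurable_loc_section P l : measurable P -> measurable (loc_section P l).
Proof.
move=> mP; rewrite -[X in measurable X]setTI.
exact: (pair1_measurable (l : loc_space H) measurableT mP).
Qed.

Lemma kernelE s P : k s P = \int[@shs_mu _ H s]_(tau in Rplus) f s P tau.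
Proof. by []. Qed.

Lemma integrandE s P tau : measurable P ->
  f s P tau = \sum_(e in hs_edges H | source e == s.1)
    (p (Defs.shift s tau) e)%:E * eta e (hs_flow s.1 s.2 tau) (loc_section P (target e)).
Proof.
move=> mP; apply: eq_bigr => e _; congr (_ * _).
have mPe := measurable_loc_section (target e) mP.
by rewrite -[X in _ = eta _ _ X]setIT -integral_indic.
Qed.

Lemma integrand_ge0 s P tau : 0 <= f s P tau.
Proof.
apply: sume_ge0 => e _; apply: mule_ge0; first by rewrite lee_fin shs_p_ge0.
by apply: integral_ge0 => v _; rewrite lee_fin.
Qed.

Lemma integrand_gt0P s P tau : measurable P ->
  0 < f s P tau <-> exists e, [/\ e \in hs_edges H, source e = s.1,
    enabled (Defs.shift s tau) e & 0 < eta e (hs_flow s.1 s.2 tau) (loc_section P (target e))].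
Proof.
move=> mP; rewrite integrandE//.
have t0 e : 0 <= (p (Defs.shift s tau) e)%:E *
    eta e (hs_flow s.1 s.2 tau) (loc_section P (target e)).
  by rewrite mule_ge0// lee_fin shs_p_ge0.
split=> [|[e [eE se en he]]].
  rewrite lt0e => /andP[ne0 _]; apply: contrapT => /forallNP nex.
  move/eqP: ne0; apply; apply: big1 => e /andP[eE /eqP se].
  have [en|nen] := pselect (enabled (Defs.shift s tau) e).
    have -> : eta e (hs_flow s.1 s.2 tau) (loc_section P (target e)) = 0.
      apply/eqP/negPn/negP => h; apply: (nex e); split=> //.
      by rewrite lt0e h measure_ge0.
    by rewrite mule0.
  have -> : p (Defs.shift s tau) e = 0%R.
    by apply/eqP/negPn/negP => h; apply: nen; apply/shs_p_gt0; rewrite lt0r h shs_p_ge0.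
  by rewrite mul0e.
rewrite (bigD1 e)/=; last by rewrite eE se eqxx.
apply: (@lt_le_trans _ _ ((p (Defs.shift s tau) e)%:E *
    eta e (hs_flow s.1 s.2 tau) (loc_section P (target e)))).
  by rewrite mule_gt0// lte_fin; exact/shs_p_gt0.
by rewrite leeDl// sume_ge0.
Qed.

Lemma enabled_guard s e : enabled s e -> hs_guard e s.2.
Proof. by move=> [s' [_ _ _ [_ ?] _]]. Qed.

(** For almost every delay the probabilities of the enabled edges sum to 1, so the kernel averages
    reset probabilities that are all at least [c]. *)
Lemma kernel_ge s P (c : R) : measurable P -> (0 <= c)%R ->
  (forall e v, e \in hs_edges H -> source e = s.1 -> hs_guard e v ->
    c%:E <= eta e v (loc_section P (target e))) ->
  c%:E <= k s P.
Proof.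
move=> mP c0 h; rewrite kernelE.
have mD := @shs_delays_measurable _ H s.
have DR : delays s `<=` Rplus by move=> tau [e _ [s' [s'' [? _ _] _]]].
apply: (@le_trans _ _ (\int[@shs_mu _ H s]_(tau in delays s) f s P tau)); last first.
  apply: ge0_subset_integral => //; first exact: shs_integrand_measurable.
  by move=> tau _; exact: integrand_ge0.
apply: (@le_trans _ _ (\int[@shs_mu _ H s]_(tau in delays s) c%:E)).
  rewrite integral_cst// -[leLHS]mule1 lee_wpmul2l ?lee_fin// le_eqVlt.
  by apply/orP; left; apply/eqP/esym; exact: shs_mu_delays.
apply: ge0_le_integral => //.
  by apply: measurable_funS DR _ => //; exact: shs_integrand_measurable.
move=> tau [e0 _ [s' [s'' [tau0 _ ->] sw]]]; rewrite integrandE//.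
rewrite -[leLHS]mul1e -[X in X * _]/(1%R%:E).
rewrite -(@shs_p_sum1 _ H (Defs.shift s tau)); last by exists e0, s'.
rewrite -sumEFin (bigID (fun e => source e == s.1))/=.
rewrite [X in _ + X]big1 ?adde0; last first.
  move=> e /andP[_ se]; congr EFin; apply/eqP; rewrite eq_le shs_p_ge0 andbT.
  rewrite leNgt; apply/negP => /shs_p_gt0[s1 [_ /= ss _ _ _]].
  by rewrite ss eqxx in se.
rewrite ge0_sume_distrl; last by move=> e _; rewrite lee_fin shs_p_ge0.
apply: lee_sum => e /andP[eE /eqP se].
have [pe|] := boolP (0 < p (Defs.shift s tau) e)%R.
  rewrite lee_wpmul2l ?lee_fin ?shs_p_ge0// h//.
  by have /shs_p_gt0/enabled_guard := pe.
by rewrite lt0r shs_p_ge0 andbT negbK => /eqP ->; rewrite !mul0e.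
Qed.

End hybrid.

(** * Finite quotients *)

(** [x0] makes the space pointed, as measurable types have to be. *)
Definition discrete_space (F : finType) (x0 : F) : Type := F.

Section discrete_space.
Variables (F : finType) (x0 : F).

HB.instance Definition _ := Choice.on (discrete_space x0).
HB.instance Definition _ := isPointed.Build (discrete_space x0) x0.
HB.instance Definition _ := @isMeasurable.Build default_measure_display
  (discrete_space x0) (@discrete_measurable (discrete_space x0))
  (@discrete_measurable0 _) (@discrete_measurableC _) (@discrete_measurableU _).

End discrete_space.

Section quotient.
Context (R : realType) (T : sts R) (F : finType) (x0 : F).
Variables (alpha : {mfun T >-> discrete_space x0}) (rep : discrete_space x0 -> T).

Definition quotient_kernel (q : discrete_space x0) :
  {measure set (discrete_space x0) -> \bar R}.
Proof.
refine (pushforward (sts_kernel T (rep q)) alpha : {measure set _ -> \bar R}).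
exact: measurable_funPT.
Defined.

Let measurable_quotient_kernel (U : set (discrete_space x0)) : measurable U ->
  measurable_fun setT (quotient_kernel ^~ U).
Proof. by []. Qed.

HB.instance Definition _ := isKernel.Build _ _ _ _ R quotient_kernel
  measurable_quotient_kernel.

Let quotient_kernelT q : quotient_kernel q setT = 1.
Proof. exact: prob_kernel. Qed.

HB.instance Definition _ := Kernel_isProbability.Build _ _ _ _ R quotient_kernel
  quotient_kernelT.

Definition quotient_sts : sts R := STS quotient_kernel.

Lemma finite_quotient_sts : finite_sts quotient_sts.
Proof. by split=> //; exact: (@finite_finset F). Qed.

End quotient.

(** * Cycle-reset systems *)

Section cycle_reset_rank.
Context (R : realType) (H : shs R).
Notation edge := (hs_loc H * hs_event H * hs_loc H)%type.

Let weak (e : edge) l l' : bool :=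
  [&& e \in hs_edges H, source e == l, target e == l' & ~~ `[< strongly_reset e >]].

(** A cycle of edges that are not strongly reset could be shortened to a simple one, against
    cycle-reset; so these edges form an acyclic graph. *)
Lemma cycle_reset_rank : cycle_reset H -> exists rank : hs_loc H -> nat,
  forall e : edge, e \in hs_edges H -> ~ strongly_reset e ->
    (rank (target e) < rank (source e))%N.
Proof.
move=> CR; pose w l l' := [exists e : edge, weak e l l'].
suff /finType_acyclic_rank[rank h] : forall x y, w x y -> ~~ connect w y x.
  exists rank => e eE ne; apply: h; apply/existsP; exists e.
  by rewrite /weak eE !eqxx/=; apply/asboolPn.
move=> x y wxy; apply/negP => /connectP[q0 pq0]; have [e0 _] := existsP wxy.
case/shortenP: pq0 => q pq uq _ xE; rewrite {x}xE in wxy.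
pose cyc := y :: q; have cw : cycle w cyc by rewrite /= rcons_path pq.
(* One weak edge is picked for each pair of consecutive vertices; there the default [e0] never
   occurs. *)
pose ed l l' := odflt e0 [pick e | weak e l l'].
have edP z : z \in cyc -> weak (ed z (next cyc z)) z (next cyc z).
  move=> /(next_cycle cw) wz; rewrite /ed; case: pickP => [e we|nw] //=.
  by case/existsP: wz => e; rewrite nw.
pose c := [seq ed z (next cyc z) | z <- cyc].
have [|e /mapP[z zc ->]] := CR c; last first.
  by have /and4P[_ _ _ /asboolPn] := edP z zc.
apply/and4P; split=> //.
- by apply/allP => _ /mapP[z zc ->]; have /and4P[] := edP z zc.
- rewrite cycle_map; apply: sub_in_cycle (cycle_next uq); last first.
    by apply/allP => z; exact: id.
  move=> a b ac bc /eqP <-; rewrite /=.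
  have /and4P[_ _ /eqP -> _] := edP a ac.
  by have /and4P[_ /eqP -> _ _] := edP (next cyc a) (etrans (mem_next cyc a) ac).
- rewrite -map_comp map_id_in// => z zc /=.
  by have /and4P[_ /eqP -> _ _] := edP z zc.
Qed.

End cycle_reset_rank.

(** * Finiteness of predecessors and uniform attraction *)

Section cycle_reset_kernel.
Context (R : realType) (H : shs R).
Notation edge := (hs_loc H * hs_event H * hs_loc H)%type.
Notation eta := (@shs_eta _ H).
Notation T := (induced_sts H).

Definition location (s : T) : hs_loc H := s.1.

Lemma measurable_location l : measurable (location @^-1` [set l]).
Proof.
rewrite -[X in measurable X]setTI.
exact: (@measurable_fst _ _ (loc_space H) (vec_space H) measurableT [set l]).
Qed.

Lemma strongly_reset_eta (e : edge) v v' A : strongly_reset e ->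
  hs_guard e v -> hs_guard e v' -> measurable A -> eta e v A = eta e v' A.
Proof. by move=> [r [m [_ _ h]]] /h[_ h1] /h[_ h2] mA; rewrite h1// h2. Qed.

(** When every edge from [l] to [l'] is strongly reset, [pre_at l l' P] depends on
    [P] only through the set of edges whose reset law charges [P]. Single edges
    cannot be used instead: the probability of taking a given edge need not be a
    measurable function of the state, only the whole kernel is. *)
Lemma finite_pre_at_strongly_reset l l' :
  (forall e : edge, e \in hs_edges H -> source e = l -> target e = l' ->
    strongly_reset e) ->
  finite_set [set pre_at location l l' P | P in measurable].
Proof.
move=> SR; apply: (@finite_image_factor _ _ {set edge} _ _ (fun P : set T =>
  [set e : edge | `[< exists2 v, hs_guard e v & 0 < eta e v (loc_section P l') >]]%SET)).
suff le P P' : measurable P -> measurable P' ->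
    (forall e : edge, (exists2 v, hs_guard e v & 0 < eta e v (loc_section P l')) ->
      (exists2 v, hs_guard e v & 0 < eta e v (loc_section P' l'))) ->
    pre_at location l l' P `<=` pre_at location l l' P'.
  move=> P P' mP mP' /setP gP; apply/seteqP; split; apply: le => // e h.
    by have := gP e; rewrite !inE => gPe; apply: (asbool_eq_equiv gPe).1.
  by have := gP e; rewrite !inE => gPe; apply: (asbool_eq_equiv gPe).2.
move=> mP mP' h s [/= ks sl]; split=> //=; move: ks.
have ml := measurable_location l'.
have mPl := measurableI _ _ mP ml; have mPl' := measurableI _ _ mP' ml.
have mRp := @measurable_Rplus R.
have mf Q : measurable Q ->
    measurable_fun [set tau : R | (0 <= tau)%R] (kappa_integrand eta (@shs_p _ H) s Q).
  exact: shs_integrand_measurable.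
rewrite /pre/= !kernelE => /(integral_gt0P _ mRp (mf _ mPl) (fun _ _ => integrand_ge0 _ _ _)).
move=> hP; apply/(integral_gt0P _ mRp (mf _ mPl') (fun _ _ => integrand_ge0 _ _ _)).
(* It suffices to compare the delays at which the integrands are positive; at each of them the same
   edge serves for [P']. *)
apply: (lt_le_trans hP); apply: le_measure; rewrite ?inE.
- exact: measurable_gt0 (mf _ mPl).
- exact: measurable_gt0 (mf _ mPl').
move=> tau [tau0 /= /(integrand_gt0P _ _ mPl)[e [eE es en he]]]; split=> //=.
apply/(integrand_gt0P _ _ mPl'); exists e; split=> //.
have [el'|el'] := pselect (target e = l'); last first.
  move: he; rewrite (_ : loc_section _ _ = set0) ?measure0 ?ltxx//.
  by apply/seteqP; split=> // v [_ /el'].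
have secE Q : loc_section (Q `&` location @^-1` [set l']) (target e) = loc_section Q l'.
  by rewrite el'; apply/seteqP; split=> [v []//|v Qv]; split.
move: he; rewrite !secE => he; have ge := enabled_guard en.
have SRe : strongly_reset e by apply: SR => //; rewrite es.
have [|v gv] := h e; first by exists (hs_flow s.1 s.2 tau).
by rewrite (strongly_reset_eta SRe gv ge)//; exact: measurable_loc_section.
Qed.

(** A strongly reset edge has a single reset law, so continuity from below gives it a uniform index;
    any other edge lowers the rank. A state of rank below [i] is thus attracted in [i] rounds. *)
Lemma attraction_cycle_reset : cycle_reset H ->
  exists r, forall A : nat -> set T,
  (forall n, measurable (A n)) -> (forall n m, (n <= m)%N -> A n `<=` A m) ->
  \bigcup_n A n = setT -> exists n, iter r (@attract _ T) (A n) = setT.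
Proof.
move=> /cycle_reset_rank[rank rankP]; exists (\max_l rank l).+1 => A mA ndA cA.
have /choice[N NP] : forall e : edge, exists n, strongly_reset e ->
    forall v, hs_guard e v -> (2^-1)%:E <= eta e v (loc_section (A n) (target e)).
  move=> e; apply: contrapT => /forallNP nN.
  have /not_implyP[SR _] := nN 0%N.
  (* The failing point may vary with [n], but all guard points share one law, so the failure holds
     at one fixed [v] for every [n]. *)
  have nv n : exists2 v, hs_guard e v & eta e v (loc_section (A n) (target e)) < (2^-1)%:E.
    have /not_implyP[_ /existsNP[v /not_implyP[gv]]] := nN n.
    by move=> /negP; rewrite -ltNge; exists v.
  have [v gv _] := nv 0%N.
  have cv : eta e v \o (fun n => loc_section (A n) (target e)) @ \oo -->
      eta e v (\bigcup_n loc_section (A n) (target e)).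
    apply: nondecreasing_cvg_mu.
    - by move=> n; exact: measurable_loc_section.
    - by apply: bigcup_measurable => n _; exact: measurable_loc_section.
    - by move=> n m nm; apply/subsetPset => x; exact: ndA.
  have : eta e v (\bigcup_n loc_section (A n) (target e)) <= (2^-1)%:E.
    rewrite -(cvg_lim _ cv)//; apply: lime_le.
      by apply/cvg_ex; eexists; exact: cv.
    apply: nearW => n /=; have [v' gv' /ltW] := nv n.
    by rewrite (strongly_reset_eta SR gv gv')//; exact: measurable_loc_section.
  rewrite (_ : \bigcup_n _ = setT).
    rewrite probability_setT lee_fin leNgt invf_lt1// ltr1n//.
  apply/seteqP; split=> // x _.
  have [n _ Ax] : (\bigcup_n A n) (target e, x) by rewrite cA.
  by exists n.
exists (\max_e N e); set n := \max_e N e.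
have mG i : measurable (iter i (@attract _ T) (A n)).
  by elim: i => [|i IH]; [exact: mA|exact: measurable_attract].
have AG i : A n `<=` iter i (@attract _ T) (A n).
  by elim: i => [//|i IH] t /IH; left.
suff G i (t : T) : (rank (location t) < i)%N -> iter i (@attract _ T) (A n) t.
  by apply/seteqP; split=> // t _; apply: G; rewrite ltnS leq_bigmax.
elim: i t => [//|i IH] t ti; right => /=; apply: kernel_ge => // e v eE et gv.
have [SR|nSR] := pselect (strongly_reset e).
  apply: (le_trans (NP e SR v gv)); apply: le_measure; rewrite ?inE//.
  - exact: measurable_loc_section.
  - exact: measurable_loc_section.
  - by move=> x /(ndA _ n (leq_bigmax e)); exact: AG.
(* The target has smaller rank, so by induction its whole fibre is already attracted. *)
rewrite (_ : loc_section _ _ = setT).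
  by rewrite probability_setT lee_fin invf_le1// ler1n.
apply/seteqP; split=> // x _; apply: IH.
by have := rankP e eE nSR; rewrite et => /leq_trans; apply; rewrite -ltnS.
Qed.

End cycle_reset_kernel.

Theorem proposition3p11 (R : realType) (H : shs R) (B : set (induced_sts H)) :
  measurable B ->
  cycle_reset H ->
  exists (T2 : sts R) (alpha : {mfun induced_sts H >-> T2}),
    [/\ finite_sts T2,
        is_sound_abstraction alpha,
        alpha_closed alpha B &
        forall l : hs_loc H,
          alpha_closed alpha [set s : induced_sts H | s.1 = l]].
Proof.
move=> mB CR; have [rank rankP] := cycle_reset_rank CR.
have fin_pre l l' : (rank l <= rank l')%N ->
    finite_set [set pre_at (@location _ H) l l' P | P in measurable].
  move=> ll'; apply: finite_pre_at_strongly_reset => e eE es et.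
  by apply: contrapT => /(rankP e eE); rewrite es et ltnNge ll'.
have mB1 : [set B] `<=` measurable by move=> _ ->.
have [_ [/finite_seqP[Gs ->] mGs BGs locGs preGs]] :=
  finite_pre_stable_family (@measurable_location _ H) fin_pre (finite_set1 B) mB1.
pose x0 := type_of Gs point.
pose f : induced_sts H -> discrete_space x0 := type_of Gs.
have mf : measurable_fun setT f.
  by move=> _ Y _; rewrite setTI; exact: measurable_type_of_preimage.
pose alpha : {mfun induced_sts H >-> discrete_space x0} :=
  HB.pack f (isMeasurableFun.Build _ _ _ _ f mf).
(* On types of no state the default [point] is harmless: the kernels are compared only at
   [alpha s]. *)
pose rep (q : discrete_space x0) : induced_sts H := xget point [set s | f s = q].
have frep s : f (rep (f s)) = f s.
  by rewrite /rep; case: xgetP => // /(_ s) /=.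
have closed P : saturated [set` Gs] P -> alpha_closed f P.
  exact: saturated_type_of.
exists (quotient_sts alpha rep), alpha; split.
- exact: finite_quotient_sts.
- apply: kernel_bisimulation_sound; last exact: attraction_cycle_reset.
  + by [].
  + move=> s A; rewrite /quotient_sts/= /quotient_kernel/= /pushforward.
    have satA : saturated [set` Gs] (pre (alpha @^-1` A)).
      by apply: preGs => u t ut; rewrite /= /f (_ : type_of Gs u = type_of Gs t)//;
        exact/type_of_eqP.
    have := (type_of_eqP Gs _ _).1 (frep s).
    move=> st; split; apply: satA => G GGs; [exact: iff_sym (st G GGs)|exact: st G GGs].
- by apply: closed; apply: saturated_mem; exact: BGs.
- by move=> l; apply: closed; apply: saturated_mem; exact: locGs.
Qed.
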